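(* Let $g\in \mathrm{Isom}(\mathbb{U}_1)$. If $d(a,g(a))=1$ for some $a\in\mathbb{U}_1$, then a product of $2^5$ conjugates of $g$ moves almost maximally, and hence any element of $\mathrm{Isom}(\mathbb{U}_1)$ can be written as the product of $2^9$ conjugates of $g$ and $g^{-1}$.
   Context: The bounded Urysohn space $\mathbb{U}_1$ of diameter $1$ is the (unique up to isometry) complete separable metric space of diameter $1$ which is homogeneous (every isometry between finite subsets extends to an isometry of the whole space onto itself) and embeds isometrically every finite metric space of diameter at most $1$; $d$ is its metric. $\mathrm{Isom}(\mathbb{U}_1)$ is the group of all isometries of $\mathbb{U}_1$ onto itself, and conjugates are taken in this group. Types: for a finite set $X\subset\mathbb{U}_1$ and $a\in\mathbb{U}_1$, the type $\mathrm{tp}(a/X)$ is determined by the distances $d(a,x)$, $x\in X$; a realisation of $\mathrm{tp}(a/X)$ is an element $b\in\mathbb{U}_1$ with $d(b,x)=d(a,x)$ for all $x\in X$. Independence: for sets $A,B,C\subset\mathbb{U}_1$ ($B$ possibly empty), $A$ and $C$ are independent over $B$ if for all $a\in A$, $c\in C$ with $d(a,c)<1$ there is some $b\in B$ with $d(a,c)=d(a,b)+d(b,c)$. Elements are identified with the corresponding singletons. An isometry $f\in\mathrm{Isom}(\mathbb{U}_1)$ moves almost maximally if for every type $\mathrm{tp}(a/X)$ with $X\subset\mathbb{U}_1$ finite there is a realisation $b$ of $\mathrm{tp}(a/X)$ such that $b$ and $f(b)$ are independent over $X$. *)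

(* Defs.v *)
From HB Require Import structures.
From mathcomp Require Import all_boot all_order all_algebra.
From mathcomp Require Import all_classical all_reals all_analysis.

Set Implicit Arguments.
Unset Strict Implicit.
Unset Printing Implicit Defensive.

Import Order.TTheory GRing.Theory Num.Theory.

Local Open Scope classical_set_scope.
Local Open Scope ring_scope.

Definition isometric (R : realType) (S T : metricType R) (f : S -> T) : Prop :=
  forall x y, mdist (f x) (f y) = mdist x y.

(* The diameter of the empty space is -oo. *)
Definition diameter (R : realType) (T : metricType R) : \bar R :=
  ereal_sup [set (mdist p.1 p.2)%:E | p in [set: T * T]].

Section IsometryGroup.
Context (R : realType) (U : metricType R).

(* [asbool] makes the predicate boolean, so that two isometries are equal as
   soon as their underlying functions are. *)
Record isom := Isom {
  isom_fun :> U -> U;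
  isomP : `[< isometric isom_fun /\ set_surj [set: U] [set: U] isom_fun >] }.

HB.instance Definition _ := [isSub for isom_fun].
HB.instance Definition _ := gen_eqMixin isom.
HB.instance Definition _ := gen_choiceMixin isom.

Implicit Types f g h : isom.

Lemma isom_isometric f : isometric f.
Proof. by have /asboolP[] := isomP f. Qed.

Lemma isom_surj f (y : U) : exists x, f x = y.
Proof. by have /asboolP[_ /(_ y I)[x _ <-]] := isomP f; exists x. Qed.

Lemma isom_inj f : injective f.
Proof.
by move=> x y fxy; apply: mdist_positivity; rewrite -(isom_isometric f) fxy mdistxx.
Qed.

Lemma isom_ext f g : (forall x, f x = g x) -> f = g.
Proof. by move=> fg; apply/val_inj/funext. Qed.

Fact isom_one_subproof :
  `[< isometric (@id U) /\ set_surj [set: U] [set: U] (@id U) >].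
Proof. by apply/asboolP; split=> // y _; exists y. Qed.

Definition isom_one := Isom isom_one_subproof.

Fact isom_mul_subproof f g :
  `[< isometric (f \o g) /\ set_surj [set: U] [set: U] (f \o g) >].
Proof.
apply/asboolP; split=> [x y /=|z _]; first by rewrite !isom_isometric.
have [y <-] := isom_surj f z; have [x <-] := isom_surj g y.
by exists x.
Qed.

Definition isom_mul f g := Isom (isom_mul_subproof f g).

Definition isom_inv_fun f (y : U) : U := sval (cid (isom_surj f y)).

Lemma isom_inv_funK f : cancel (isom_inv_fun f) f.
Proof. by move=> y; rewrite /isom_inv_fun; case: cid. Qed.

Fact isom_inv_subproof f :
  `[< isometric (isom_inv_fun f) /\
      set_surj [set: U] [set: U] (isom_inv_fun f) >].
Proof.
apply/asboolP; split=> [x y|x _].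
  by rewrite -(isom_isometric f) !isom_inv_funK.
by exists (f x) => //; apply: (@isom_inj f); rewrite isom_inv_funK.
Qed.

Definition isom_inv f := Isom (isom_inv_subproof f).

Fact isom_mulA : associative isom_mul.
Proof. by move=> f g h; apply: isom_ext. Qed.

Fact isom_mul1 : left_id isom_one isom_mul.
Proof. by move=> f; apply: isom_ext. Qed.

Fact isom_mulr1 : right_id isom_one isom_mul.
Proof. by move=> f; apply: isom_ext. Qed.

Fact isom_mulV : left_inverse isom_one isom_inv isom_mul.
Proof.
move=> f; apply: isom_ext => x /=.
by apply: (@isom_inj f); rewrite isom_inv_funK.
Qed.

Fact isom_mulrV : right_inverse isom_one isom_inv isom_mul.
Proof. by move=> f; apply: isom_ext => x /=; rewrite isom_inv_funK. Qed.

HB.instance Definition _ :=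
  isGroup.Build isom isom_mulA isom_mul1 isom_mulr1 isom_mulV isom_mulrV.

End IsometryGroup.

(* An isometry between finite subsets A and B of U is represented by a total
   function p : U -> U of which only the restriction to A matters (B is then
   the image of A under p). *)
Definition homogeneous (R : realType) (U : metricType R) : Prop :=
  forall (A : set U) (p : U -> U), finite_set A ->
    (forall x y, A x -> A y -> mdist (p x) (p y) = mdist x y) ->
    exists f : isom U, forall x, A x -> f x = p x.

(* These properties determine U up to isometry. *)
Record bounded_urysohn (R : realType) (U : metricType R) : Prop := {
  urysohn_complete :
    forall F : set_system U, ProperFilter F -> cauchy F ->
      exists x : U, F --> x;
  urysohn_separable : exists2 D : set U, countable D & dense D;
  urysohn_diameter : diameter U = 1%E;
  urysohn_homogeneous : homogeneous U;
  urysohn_universal :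
    forall T : metricType R, finite_set [set: T] -> (diameter T <= 1)%E ->
      exists e : T -> U, isometric e }.

Section Independence.
Context (R : realType) (U : metricType R).

Definition realises_tp (b a : U) (X : set U) : Prop :=
  forall x, X x -> mdist b x = mdist a x.

(* A and C are independent over B *)
Definition indep (A B C : set U) : Prop :=
  forall a c, A a -> C c -> mdist a c < 1 ->
    exists2 b, B b & mdist a c = mdist a b + mdist b c.

Definition moves_almost_maximally (f : isom U) : Prop :=
  forall (X : set U) (a : U), finite_set X ->
    exists2 b, realises_tp b a X & indep [set b] X [set f b].

End Independence.

(* Main.v *)
Require Import Defs.
From HB Require Import structures.
From mathcomp Require Import all_boot all_order all_algebra.
From mathcomp Require Import all_classical all_reals all_analysis.
From mathcomp Require Import lra.

(** Everything goes through isometries that move every point by the full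
distance 1, [displaces 1 k].  Such a [k] moves almost maximally for a trivial
reason: independence of [b] and [k b] only constrains distances below 1.

Why a product of [2 ^ n] conjugates of [g], [2 <= n], displaces by 1.  The
point moved by 1 forces [g] to move some realisation of every type over a
finite set either by 1/2 or as far as that set allows ([moved_roams]).  Choose
a conjugate [g ^ h] generic with respect to [g].  The finitely many known
values of [h] then never force [d t ((g ^ h) s) + d (g t) s] below a constant
[de]; this inequality is preserved by a back-and-forth construction of [h],
survives the passage to the limit, and at [t = (g ^ h) s] it says that
[g * g ^ h] displaces by [de] ([displaces_mulJ]).  The constant is the
displacement already present everywhere plus the displacement available at
generic points, so one doubling yields 1/2, a second one 1, and further ones
keep 1.  Hence [2 ^ 5] conjugates already displace by 1.

Why every isometry [f] is [V^-1 * U] with [U] and [V] products of four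
conjugates of [k], for any [k] displacing by 1 ([factorisation]).  The eight
conjugating isometries are built together by back-and-forth.  Consider the
orbit [X0, X1, X2, X3, X4] of a finite set under the four factors of [U], each
factor being conjugated by an isometry known on two consecutive layers.  If the
layers are sufficiently independent, the conjugating isometries can be changed
off the layers so that [U] agrees, on any further finite set [E], with any
isometry that it agrees with on [X0] ([extend_chain]): push [E] one step
forward from [X0] and its prescribed image one step backward from [X4]; since
[k] displaces by 1, the new points can be kept independent of [X2] over [X1]
and [X3], and the two halves are amalgamated over [X2] ([amalgamate]).  Any
four factors acquire independent layers after a change off a prescribed finite
set ([make_layers_independent]).  So one side of [V * f = U] is made
independent, the other side is extended to solve the equation on its first
layer, and the same move applies to the mirrored equation [U * f^-1 = V]
([solve_other_side]).

With [k] a product of [2 ^ 6] conjugates of [g], [U] and [V] have [2 ^ 8]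
factors each, and [V^-1] contributes conjugates of [g^-1]. *)

Set Implicit Arguments.
Unset Strict Implicit.
Unset Printing Implicit Defensive.

Import Order.TTheory GRing.Theory Num.Theory.

Local Open Scope ring_scope.

(** * Isometries acting on points *)

Section IsometryAction.
Context (R : realType) (U : metricType R).
Implicit Types (f g h m : isom U) (x y : U).

Lemma isomM f g x : (f * g)%g x = f (g x). Proof. by []. Qed.

Lemma isom1 x : (1%g : isom U) x = x. Proof. by []. Qed.

Lemma isomVK f x : (f^-1)%g (f x) = x.
Proof. by rewrite -isomM mulVg. Qed.

Lemma isomKV f x : f (f^-1%g x) = x.
Proof. by rewrite -isomM mulgV. Qed.

Lemma isomJ f h x : (f ^ h)%g x = h^-1%g (f (h x)).
Proof. by rewrite conjgE. Qed.

Lemma isom_distVl f x y : mdist (f^-1%g x) y = mdist x (f y).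
Proof. by rewrite -(isom_isometric f) isomKV. Qed.

Lemma isom_distVr f x y : mdist x (f^-1%g y) = mdist (f x) y.
Proof. by rewrite -(isom_isometric f) isomKV. Qed.

Lemma isomV_fix f x : f x = x -> (f^-1)%g x = x.
Proof. by move=> {1}<-; rewrite isomVK. Qed.

End IsometryAction.

(** * One-point extensions and independence *)

Section Urysohn.
Context (R : realType) (U : metricType R) (hU : bounded_urysohn U).
Implicit Types (f g h k m : isom U) (a b c p q x y z : U).
Implicit Types (A B C E F L X : seq U).

Local Notation d := (@mdist R U).
Local Notation tri := (@metric_triangle R U).
Local Notation sym := (@metric_sym R U).

Lemma dist_le1 x y : d x y <= 1.
Proof.
have := urysohn_diameter hU; rewrite /diameter => h.
rewrite -lee_fin -h; apply: ereal_sup_ubound.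
by exists (x, y).
Qed.

Lemma extend_isometry L (p : U -> U) :
  {in L &, forall x y, d (p x) (p y) = d x y} ->
  exists f : isom U, {in L, forall x, f x = p x}.
Proof.
move=> pL; have [f fp] := urysohn_homogeneous hU (finite_seq L) pL.
by exists f => x xL; apply: fp.
Qed.

(** Homogeneity makes types visible in the group: realisations of [tp(a/L)] are
the images of [a] under the isometries fixing [L] pointwise. *)
Lemma move_point L a w : {in L, forall x, d w x = d a x} ->
  exists2 m : isom U, {in L, forall x, m x = x} & m a = w.
Proof.
move=> wa; pose p x := if x == a then w else x.
have aw : a \in L -> a = w.
  by move=> /wa; rewrite mdistxx => /mdist_positivity.
have [|f fp] := @extend_isometry (a :: L) p.
  move=> x y; rewrite !inE /p.
  case: eqVneq => [->|_]; case: eqVneq => [->|_] //=.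
  - by rewrite !mdistxx.
  - by move=> _ /wa.
  - by move=> /wa + _; rewrite sym [RHS]sym.
exists f; last by rewrite fp ?mem_head// /p eqxx.
move=> x xL; rewrite fp ?inE ?xL ?orbT// /p; case: eqVneq => [xa|//].
by rewrite xa -aw// -xa.
Qed.

Section OnePointExtension.
Variables (L : seq U) (r : U -> R).
Hypothesis r_range : {in L, forall x, 0 < r x <= 1}.
Hypothesis r_lip : {in L &, forall x y, r x <= d x y + r y}.
Hypothesis r_tri : {in L &, forall x y, d x y <= r x + r y}.

Let T : choiceType := option (seq_sub L).

Let dT (s t : T) : R :=
  match s, t with
  | None, None => 0
  | Some x, None => r (val x)
  | None, Some y => r (val y)
  | Some x, Some y => d (val x) (val y)
  end.

Let dTxx s : dT s s = 0.
Proof. by case: s => //= x; rewrite mdistxx. Qed.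

Let dT_pos s t : dT s t = 0 -> s = t.
Proof.
case: s t => [x|] [y|] //=.
- by move=> /mdist_positivity/val_inj ->.
- by move=> r0; have := r_range (valP x); rewrite r0 ltxx.
- by move=> r0; have := r_range (valP y); rewrite r0 ltxx.
Qed.

Let dT_sym s t : dT s t = dT t s.
Proof. by case: s t => [x|] [y|] //=; rewrite sym. Qed.

Let dT_tri t s u : dT s u <= dT s t + dT t u.
Proof.
have rg (x : seq_sub L) : 0 < r (val x) /\ r (val x) <= 1.
  exact/andP/r_range/valP.
case: s t u => [x|] [y|] [z|] //=.
- exact: tri.
- exact/r_lip/valP/valP.
- exact/r_tri/valP/valP.
- by rewrite addr0.
- by rewrite addrC sym; apply/r_lip/valP/valP.
- by have [] := rg y; lra.
- by rewrite add0r.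
Qed.

(** [L] with one ideal point at the distances [r] is a finite metric space of
diameter at most 1.  Universality gives a copy of it in [U], and homogeneity
carries the copy of [L] back onto [L]. *)
Lemma realise_type : exists w, {in L, forall x, d w x = r x}.
Proof.
pose mix := isMetric.Build R T dTxx dT_pos dT_sym dT_tri.
pose M : metricType R := HB.pack T mix.
have finM : finite_set [set: M].
  exact: (@finite_finset (option (seq_sub L))).
have diamM : (diameter M <= 1)%E.
  apply: ge_ereal_sup => _ [[s t] _ <-]; rewrite lee_fin /=.
  have rg (x : seq_sub L) : 0 < r (val x) /\ r (val x) <= 1.
  exact/andP/r_range/valP.
  case: s t => [x|] [y|]; rewrite /mdist /=.
  - exact: dist_le1.
  - by have [] := rg x.
  - by have [] := rg y.
  - exact: ler01.
have [e eM] := urysohn_universal hU finM diamM.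
pose back y : U := if [pick x : seq_sub L | e (Some x) == y] is Some x
                   then val x else y.
have backK (x : seq_sub L) : back (e (Some x)) = val x.
  rewrite /back; case: pickP => [x' /eqP ee|/(_ x)]; last by rewrite eqxx.
  have : mdist (e (Some x')) (e (Some x)) = 0 by rewrite ee mdistxx.
  by rewrite eM => /dT_pos[->].
have [|f fe] := @extend_isometry [seq e (Some x) | x : seq_sub L] back.
  by move=> _ _ /codomP[x ->] /codomP[y ->]; rewrite !backK eM.
exists (f (e None)) => x xL.
pose x' : seq_sub L := SeqSub xL.
have fx' : f (e (Some x')) = x by rewrite fe ?backK ?codom_f.
rewrite -[in LHS]fx' isom_isometric eM //.
Qed.

End OnePointExtension.

(** The largest distances to a realisation of the type [r] over [L] that the
triangle inequality permits: shortest paths through [L], cut off at 1. *)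
Definition free_ext L (r : U -> R) p : R :=
  foldr (fun x v => Num.min (r x + d x p) v) 1 L.

Lemma free_ext_le1 L r p : free_ext L r p <= 1.
Proof. by elim: L => //= x L IH; rewrite ge_min IH orbT. Qed.

Lemma free_ext_le L r p x : x \in L -> free_ext L r p <= r x + d x p.
Proof.
elim: L => //= y L IH; rewrite inE ge_min => /predU1P[->|/IH ->].
  by rewrite lexx.
by rewrite orbT.
Qed.

Lemma free_ext_attained L r p : free_ext L r p = 1 \/
  exists2 x, x \in L & free_ext L r p = r x + d x p.
Proof.
elim: L => [|y L IH] /=; first by left.
rewrite /Num.min; case: ifP => _; first by right; exists y; rewrite ?mem_head.
by case: IH => [->|[x xL ->]]; [left|right; exists x; rewrite ?inE ?xL ?orbT].
Qed.

(** In a space of diameter 1 this is [indep] for the singletons of [a] and [c]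
over the entries of [B]: the inequality is an equality by the triangle
inequality. *)
Definition ind B a c :=
  1 <= d a c \/ exists2 b, b \in B & d a b + d b c <= d a c.

Lemma realise_type_free L C (r : U -> R) :
  {in L, forall x, 0 < r x <= 1} ->
  {in L &, forall x y, r x <= d x y + r y} ->
  {in L &, forall x y, d x y <= r x + r y} ->
  exists w, {in L, forall x, d w x = r x} /\ {in C, forall p, ind L w p}.
Proof.
move=> rg rl rt; pose e := free_ext L r.
have eL x : x \in L -> e x = r x.
  move=> xL; apply/eqP; rewrite /e eq_le; apply/andP; split.
    by have := free_ext_le r x xL; rewrite mdistxx addr0.
  have [->|[y yL ->]] := free_ext_attained L r x.
    by have /andP[] := rg _ xL.
  by rewrite addrC sym; apply: rl.
have [| | |w we] := @realise_type (L ++ C) e.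
- move=> p _; rewrite free_ext_le1 andbT /e.
  have [->|[y yL ->]] := free_ext_attained L r p; first exact: ltr01.
  have /andP[+ _] := rg _ yL; have := mdist_ge0 y p; lra.
- move=> p q _ _; rewrite /e.
  have [->|[y yL ->]] := free_ext_attained L r q.
    have := free_ext_le1 L r p; have := mdist_ge0 p q; lra.
  have := free_ext_le r p yL; have := tri y q p; rewrite (sym q p); lra.
- move=> p q _ _; rewrite /e.
  have ge0 y : y \in L -> 0 < r y by move=> /rg/andP[].
  have := dist_le1 p q.
  have [->|[x xL ->]] := free_ext_attained L r p.
    have [->|[y yL ->]] := free_ext_attained L r q; first lra.
    have := ge0 _ yL; have := mdist_ge0 y q; lra.
  have [->|[y yL ->]] := free_ext_attained L r q.
    have := ge0 _ xL; have := mdist_ge0 x p; lra.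
  have := rt _ _ xL yL; have := tri p x q; have := tri x y q.
  rewrite (sym p x); lra.
exists w; split=> [x xL|p pC]; first by rewrite we ?eL// mem_cat xL.
rewrite /ind we ?mem_cat ?pC ?orbT// /e.
have [->|[x xL ->]] := free_ext_attained L r p; first by left; rewrite lexx.
by right; exists x; rewrite ?we ?eL ?mem_cat ?xL.
Qed.

Lemma ind_sym B a c : ind B a c -> ind B c a.
Proof.
case=> [le1|[b bB le]]; first by left; rewrite sym.
by right; exists b; rewrite // addrC (sym b) (sym c b) (sym c a).
Qed.

Lemma ind_l B a c : a \in B -> ind B a c.
Proof. by move=> aB; right; exists a; rewrite // mdistxx add0r. Qed.

Lemma ind_r B a c : c \in B -> ind B a c.
Proof. by move=> aB; right; exists c; rewrite // mdistxx addr0. Qed.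

(** Transitivity: the part of a shortest path from [a] to [c] that leads from
[B] to [c] is rerouted through [X]. *)
Lemma ind_trans B X a c :
  ind B a c -> {in B, forall b, ind X b c} -> ind X a c.
Proof.
case=> [?|[b bB le] /(_ b bB)]; first by left.
have ab := mdist_ge0 a b.
case=> [?|[x xX le']]; [left; lra|right; exists x => //].
have := tri a b x; lra.
Qed.

Lemma ind_isom f B a c : ind B a c -> ind (map f B) (f a) (f c).
Proof.
case=> [?|[b bB le]]; first by left; rewrite isom_isometric.
by right; exists (f b); rewrite ?map_f// !isom_isometric.
Qed.

(** A distance between independent points is a shortest path through [X], so it
depends only on the distances to [X]. *)
Lemma stationarity X a a' c : {in X, forall x, d a x = d a' x} ->
  ind X a c -> ind X a' c -> d a c = d a' c.
Proof.
move=> aa'; suff le b b' : {in X, forall x, d b x = d b' x} ->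
    ind X b' c -> d b c <= d b' c.
  move=> i i'; apply/eqP; rewrite eq_le !le// => x xX; exact/esym/aa'.
move=> bb' [?|[x xX]]; first by have := dist_le1 b c; lra.
by rewrite -bb'//; apply/le_trans/tri.
Qed.

(** Existence of independent realisations, with the point [a] and its new
position linked by an element of the group. *)
Lemma move_free a F C : exists2 m : isom U,
  {in F, forall x, m x = x} & {in C, forall p, ind F (m a) p}.
Proof.
have [aF|aF] := boolP (a \in F).
  by exists 1%g => // p _; apply: ind_l.
have [| | |w [wF wC]] := @realise_type_free F C (d a).
- move=> x xF; rewrite dist_le1 mdist_gt0 andbT.
  by apply: contraNneq aF => ->.
- by move=> x y _ _; rewrite addrC (sym x y) tri.
- by move=> x y _ _; rewrite (sym a x) tri.
by have [m mF ma] := move_point wF; exists m => // p pC; rewrite ma; apply: wC.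
Qed.

Lemma move_free_seq E F C : exists2 m : isom U,
  {in F, forall x, m x = x} & {in E & C, forall e p, ind F (m e) p}.
Proof.
elim: E => [|e E [m mF mE]]; first by exists 1%g.
have [n nF ne] := move_free (m e) (F ++ map m E) C.
exists (n * m)%g => [x xF|e' p]; rewrite isomM.
  by rewrite mF// nF// mem_cat xF.
rewrite inE => /predU1P[->|e'E] pC; last first.
  by rewrite nF ?mem_cat ?map_f ?orbT//; apply: mE.
apply: ind_trans (ne _ pC) _ => b; rewrite mem_cat => /orP[/ind_l//|].
by case/mapP=> e1 e1E ->; apply: mE.
Qed.


(** * Displacement of points *)

Definition displaces (al : R) g := forall x, al <= d x (g x).

(** A realisation [w] of [tp(a/F)] cannot be moved further than 1 or than a
path [w, p, g q, g w] with [p] and [q] in [F].  The last clause lets [w] be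
moved as far as the shorter of these paths and [be] allow, while the two
clauses before it keep [w] independent of the images of [F] under [g] and
[g^-1]. *)
Definition roams (be : R) g := forall F a, exists m : isom U,
  [/\ {in F, forall x, m x = x},
      {in F, forall p, ind F (m a) (g p)},
      {in F, forall p, ind F (m a) (g^-1%g p)} &
      be <= d (m a) (g (m a)) \/
      exists p q, [/\ p \in F, q \in F &
        d (m a) p + d p (g q) + d q (m a) <= d (m a) (g (m a))]].

(** With the displacement given for free, it suffices to be independent of the
images of [F]. *)
Lemma displaces_roams be g : displaces be g -> roams be g.
Proof.
move=> g_be F a.
have [m mF ma] := move_free a F (map g F ++ map g^-1%g F).
exists m; split=> // [p pF|p pF|]; last by left.
- by apply: ma; rewrite mem_cat map_f.
- by apply: ma; rewrite mem_cat (map_f (g^-1)%g) ?orbT.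
Qed.

(** Walk away from [a] in two steps of length 1/2, staying at distance 1 from
the image of the previous point: the triangle inequality leaves a displacement
of 1/2, and two steps reach distance 1 from [C]. *)
Lemma far_moved_point g a C : d a (g a) = 1 ->
  exists b, 2^-1 <= d b (g b) /\ {in C, forall p, 1 <= d b p}.
Proof.
move=> ga.
have half x F : exists w, d w x = 2^-1 /\ {in F, forall p, ind [:: x] w p}.
  have [| | |w [wx wF]] := @realise_type_free [:: x] F (fun=> 2^-1).
  - by move=> y _; lra.
  - by move=> y z _ _; have := mdist_ge0 y z; lra.
  - by move=> y z _ _; have := dist_le1 y z; lra.
  by exists w; split; rewrite ?wx ?mem_head.
have moved x w : d w x = 2^-1 -> 1 <= d w (g x) -> 2^-1 <= d w (g w).
  move=> wx wgx; have := tri w (g w) (g x); rewrite isom_isometric; lra.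
have [b [ba bC]] := half a (g a :: C).
have bga : 1 <= d b (g a).
  have [//|[x]] := bC _ (mem_head _ _); rewrite inE => /eqP->; lra.
have bg := moved _ _ ba bga.
have bC2 p : p \in C -> 2^-1 <= d b p.
  move=> pC; have [|?|[x]] := bC p; [by rewrite inE pC orbT|lra|].
  rewrite inE => /eqP->; have := mdist_ge0 a p; lra.
have [c [cb cC]] := half b (g b :: C).
have cgb : 1 <= d c (g b).
  have [//|[x]] := cC _ (mem_head _ _); rewrite inE => /eqP->; lra.
exists c; split=> [|p pC]; first exact: moved cb cgb.
have [|//|[x]] := cC p; first by rewrite inE pC orbT.
by rewrite inE => /eqP->; have := bC2 p pC; lra.
Qed.

(** If [w] is at distance 1/2 from [c] but far from [g c], then [g w], being at
distance 1/2 from [g c], is far from [w].  The auxiliary point [c] is obtained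
in the same way from a point [b] that is moved by 1/2 and lies at distance 1
from [F] and its images, hence is compatible with any prescribed distances, at
least 1/2, from [c] to [F]. *)
Lemma moved_roams g a : d a (g a) = 1 -> roams 2^-1 g.
Proof.
move=> ga F w0.
have [w0F|w0F] := boolP (w0 \in F).
  exists 1%g; split=> // [p _|p _|]; [exact: ind_l|exact: ind_l|right].
  by exists w0, w0; rewrite mdistxx !isom1 addr0 add0r.
pose G := map g F ++ map g^-1%g F.
have [b [bg bF]] := far_moved_point (F ++ G) ga.
have gF p : p \in F -> g p \in G by move=> pF; rewrite mem_cat map_f.
have gVF p : p \in F -> g^-1%g p \in G.
  by move=> pF; rewrite mem_cat (map_f (g^-1)%g) ?orbT.
have bF1 p : p \in F -> 1 <= d b p by move=> pF; apply: bF; rewrite mem_cat pF.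
have bG1 p : p \in G -> 1 <= d b p.
  by move=> pF; apply: bF; rewrite mem_cat pF orbT.
have bnF : b \notin F.
  by apply/negP => /bF1; rewrite mdistxx ler10.
pose r x := if x == b then 2^-1 else Num.min 1 (d w0 x + 2^-1).
have rb : r b = 2^-1 by rewrite /r eqxx.
have rF p : p \in F -> r p = Num.min 1 (d w0 p + 2^-1).
  by move=> pF; rewrite /r (negPf (memPn bnF _ pF)).
have rle p : p \in F -> r p <= 1 /\ r p <= d w0 p + 2^-1.
  by move=> /rF ->; rewrite !ge_min !lexx orbT.
have rge p : p \in F -> r p = 1 \/ r p = d w0 p + 2^-1.
  by move=> /rF ->; rewrite /Num.min; case: ifP; [left|right].
have rhalf x : 2^-1 <= r x.
  rewrite /r; case: ifP => // _; rewrite le_min; apply/andP; split; first lra.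
  have := mdist_ge0 w0 x; lra.
(* [c] is as far from [F] as its distance 1/2 to the future point [w] allows *)
have [| | |c [cr cfree]] := @realise_type_free (b :: F) (g b :: G) r.
- move=> x; rewrite inE => /predU1P[->|/rle[]]; first lra.
  have := rhalf x; lra.
- move=> x y; rewrite !inE => /predU1P[->|xF] /predU1P[->|yF].
  + by rewrite mdistxx add0r.
  + have := rhalf y; have := mdist_ge0 b y; lra.
  + have := rle _ xF; have := bF1 _ xF; rewrite sym; lra.
  + have [? ?] := rle _ xF; have := tri w0 y x; rewrite (sym y x).
    have := mdist_ge0 x y; case: (rge _ yF) => ->; lra.
- move=> x y _ _; have := rhalf x; have := rhalf y; have := dist_le1 x y; lra.
have cb : d c b = 2^-1 by rewrite cr ?mem_head.
have cF p : p \in F -> d c p = r p by move=> pF; rewrite cr ?inE ?pF ?orbT.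
have cG p : p \in G -> 2^-1 <= d c p.
  move=> pG; have [|?|[x]] := cfree p; first by rewrite inE pG orbT.
    by lra.
  by move=> /cr ->; have := rhalf x; have := mdist_ge0 x p; lra.
have cgb : 1 <= d c (g b).
  have [//|[x xbF]] := cfree _ (mem_head _ _); rewrite cr//.
  move: xbF; rewrite inE => /predU1P[->|xF]; first lra.
  have := bG1 _ (gVF _ xF); rewrite sym isom_distVl; have := rhalf x; lra.
have cg : 2^-1 <= d c (g c).
  have := tri c (g c) (g b); rewrite isom_isometric; lra.
have cgF p : p \in F -> 1 <= d c (g^-1%g p) \/
    exists2 q, q \in F & d w0 q + 2^-1 + d q (g^-1%g p) <= d c (g^-1%g p).
  move=> pF; have [|?|[x]] := cfree (g^-1%g p).
  - by rewrite inE gVF ?orbT.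
  - by left.
  rewrite inE => /predU1P[->|xF].
    by have := bG1 _ (gVF _ pF); have := mdist_ge0 c b; left; lra.
  rewrite cF//; have := mdist_ge0 x (g^-1%g p).
  by case: (rge _ xF) => ->; [left; lra|right; exists x => //; lra].
pose r' x := if x == c then 2^-1 else d w0 x.
have r'c : r' c = 2^-1 by rewrite /r' eqxx.
have r'F p : p \in F -> r' p = d w0 p.
  rewrite /r'; case: eqVneq => [->|//] cinF.
  by have := cF _ cinF; rewrite mdistxx; have := rhalf c; lra.
have w0pos p : p \in F -> 0 < d w0 p.
  by move=> pF; rewrite mdist_gt0; apply: contraNneq w0F => ->.
(* [w] realises the type of [w0] at distance 1/2 from [c], and is otherwise
   independent, so that [d w (g c)] exceeds 1/2 as much as [F] allows *)
have [| | |w [wr wfree]] := @realise_type_free (c :: F) (g c :: G) r'.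
- move=> x; rewrite inE => /predU1P[->|xF]; first lra.
  by rewrite r'F// w0pos// dist_le1.
- move=> x y; rewrite !inE => /predU1P[->|xF] /predU1P[->|yF].
  + by rewrite mdistxx add0r.
  + rewrite r'c r'F// cF//; have := w0pos _ yF; have := rhalf y; lra.
  + rewrite r'c r'F// (sym x c) cF//; have := dist_le1 w0 x; have := w0pos _ xF.
    case: (rge _ xF) => ->; lra.
  + by rewrite !r'F//; have := tri w0 y x; rewrite (sym y x); lra.
- move=> x y; rewrite !inE => /predU1P[->|xF] /predU1P[->|yF].
  + by rewrite mdistxx r'c; lra.
  + by rewrite r'c r'F// cF//; have := rle _ yF; lra.
  + by rewrite r'c r'F// (sym x c) cF//; have := rle _ xF; lra.
  + by rewrite !r'F//; have := tri x w0 y; rewrite (sym x w0); lra.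
have wc : d w c = 2^-1 by rewrite wr ?mem_head.
have wF p : p \in F -> d w p = d w0 p.
  by move=> pF; rewrite wr ?inE ?pF ?orbT// r'F.
have wG p : p \in G -> ind F w p.
  move=> pG; have [|?|[x]] := wfree p; first by rewrite inE pG orbT.
    by left.
  rewrite inE => /predU1P[->|xF le]; last by right; exists x.
  by rewrite wc; have := cG _ pG; left; lra.
have [m mF mw] := move_point wF.
exists m; rewrite mw; split=> // [p pF|p pF|]; try by apply: wG; auto.
have wgw : d w (g c) <= d w (g w) + 2^-1.
  by have := tri w (g w) (g c); rewrite isom_isometric wc.
have [?|[x]] := wfree _ (mem_head _ _); first by left; lra.
rewrite inE => /predU1P[->|xF]; first by rewrite wc; left; lra.
have : d x (g c) = d c (g^-1%g x) by rewrite isom_distVr sym.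
case: (cgF _ xF) => [|[q qF]]; first by have := mdist_ge0 w x; left; lra.
rewrite isom_distVr (sym (g q)) => ? ? ?.
right; exists x, q; split=> //; rewrite (sym q w) (wF q)//; lra.
Qed.

(** * Back-and-forth constructions *)

Definition converges (hs : nat -> isom U) (h : U -> U) := forall x (e : R),
  0 < e -> exists N, forall n, (N <= n)%N -> d (hs n x) (h x) < e.

Lemma small_eq x y : (forall e : R, 0 < e -> d x y < e) -> x = y.
Proof.
move=> xy; apply/eqP; rewrite -[_ == _]negbK -mdist_gt0; apply/negP => pos.
by have := xy _ pos; rewrite ltxx.
Qed.

Lemma converges_const h : converges (fun=> h) h.
Proof. by move=> x e e0; exists 0%N => n _; rewrite mdistxx. Qed.

Lemma converges_mul hs ks (h k : isom U) :
  converges hs h -> converges ks k ->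
  converges (fun n => (hs n * ks n)%g) (h * k)%g.
Proof.
move=> ch ck x e e0.
have [N hN] := ch (k x) (e / 2) ltac:(lra).
have [N' hN'] := ck x (e / 2) ltac:(lra).
exists (maxn N N') => n; rewrite geq_max => /andP[/hN nN /hN' nN'].
have := tri (hs n (ks n x)) (hs n (k x)) (h (k x)).
rewrite isom_isometric !isomM; lra.
Qed.

Lemma converges_inv hs h :
  converges hs h -> converges (fun n => (hs n)^-1%g) (h^-1)%g.
Proof.
move=> ch x e e0; have [N hN] := ch (h^-1%g x) e e0.
by exists N => n /hN; rewrite isom_distVl isomKV sym.
Qed.

Section PointwiseLimit.
Variables (hs : nat -> isom U) (W : nat -> seq U).
Hypothesis W_grows : forall n, {subset W n <= W n.+1}.
Hypothesis hs_stable : forall n, {in W n, hs n.+1 =1 hs n}.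
Hypothesis W_dense : forall x (e : R), 0 < e ->
  exists n, exists2 w, w \in W n & d x w < e.

Lemma grows_le (m n : nat) : (m <= n)%N -> {subset W m <= W n}.
Proof.
elim: n => [|n IH]; first by rewrite leqn0 => /eqP->.
by rewrite leq_eqVlt => /predU1P[->//|/IH s x /s/W_grows].
Qed.

Lemma stable_le (m n : nat) : (m <= n)%N -> {in W m, hs n =1 hs m}.
Proof.
elim: n => [|n IH]; first by rewrite leqn0 => /eqP->.
rewrite leq_eqVlt => /predU1P[->//|mn x xW].
by rewrite hs_stable ?IH//; apply: grows_le xW.
Qed.

Lemma pointwise_limit : exists h : U -> U, converges hs h.
Proof.
suff lim x : exists y, forall e : R, 0 < e ->
    exists N, forall n, (N <= n)%N -> d (hs n x) y < e.
  by have [h hP] := choice lim; exists h.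
have [|y Fy] := @urysohn_complete _ _ hU
  ((fun n => hs n x) @ \oo)%classic.
  apply: cauchy_exP => e e0.
  have [N [w wW xw]] := W_dense x (divr_gt0 e0 (ltr0n _ 2)).
  exists (hs N x), N => // n /= Nn; rewrite ballEmdist /=.
  have := tri (hs N x) (hs N w) (hs n x); rewrite -{2}(stable_le Nn wW).
  rewrite !isom_isometric (sym w); lra.
exists y => e e0.
have [N _ hN] := (metricType_numDomainType.fcvgrPdist_lt y).1 Fy e e0.
by exists N => n Nn; rewrite sym; apply: hN.
Qed.

End PointwiseLimit.

(** Stability on a dense union makes the sequence pointwise Cauchy.  The last
hypothesis is the same density for the inverses, whose limit provides preimages
and thus surjectivity. *)
Lemma isometry_limit (hs : nat -> isom U) (W : nat -> seq U) :
  (forall n, {subset W n <= W n.+1}) ->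
  (forall n, {in W n, hs n.+1 =1 hs n}) ->
  (forall x (e : R), 0 < e -> exists n, exists2 w, w \in W n & d x w < e) ->
  (forall x (e : R), 0 < e ->
     exists n, exists2 w, w \in W n & d x (hs n w) < e) ->
  exists2 h : isom U, converges hs h & forall n, {in W n, h =1 hs n}.
Proof.
move=> Wg hst Wd Wd'.
have [h ch] := pointwise_limit Wg hst Wd.
have [||y e e0|h' ch'] := @pointwise_limit (fun n => (hs n)^-1%g)
  (fun n => map (hs n) (W n)).
- move=> n _ /mapP[w wW ->]; rewrite -hst//.
  by apply/map_f/Wg.
- by move=> n _ /mapP[w wW ->]; rewrite isomVK -hst// isomVK.
- have [n [w wW yw]] := Wd' y e e0.
  by exists n, (hs n w) => //; apply: map_f.
have hP : `[< isometric h /\ set_surj [set: U] [set: U] h >].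
  apply/asboolP; split=> [x y|y _].
    apply/eqP; rewrite -subr_eq0 -normr_le0; apply/ler_addgt0Pr => e e0.
    have [N hN] := ch x (e / 2) ltac:(lra).
    have [N' hN'] := ch y (e / 2) ltac:(lra).
    have {hN} := hN _ (leq_maxl N N'); have {hN'} := hN' _ (leq_maxr N N').
    set n := maxn N N' => hy hx.
    have := isom_isometric (hs n) x y.
    have := tri (hs n x) (h x) (hs n y).
    have := tri (h x) (h y) (hs n y).
    have := tri (h x) (hs n x) (h y).
    have := tri (hs n x) (hs n y) (h y).
    rewrite (sym (h x) (hs n x)) (sym (h y) (hs n y)) ler_norml.
    by move=> *; apply/andP; split; lra.
  exists (h' y) => //; apply: small_eq => e e0.
  have [N hN] := ch (h' y) (e / 2) ltac:(lra).
  have [N' hN'] := ch' y (e / 2) ltac:(lra).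
  have {hN} := hN _ (leq_maxl N N'); have {hN'} := hN' _ (leq_maxr N N').
  set n := maxn N N'; rewrite isom_distVl => hy hx.
  have := tri (h (h' y)) (hs n (h' y)) y.
  rewrite (sym (h (h' y)) (hs n _)) (sym (hs n _) y); lra.
exists (Isom hP) => // n w wW; apply: small_eq => e e0 /=.
have [N hN] := ch w e e0.
by rewrite sym -(stable_le Wg hst (leq_maxl n N) wW) hN ?leq_maxr.
Qed.

Lemma dense_sequence a : exists s : nat -> U,
  forall x (e : R), 0 < e -> exists n, d x (s n) < e.
Proof.
have [D /countable_injP[j j_inj] D_dense] := urysohn_separable hU.
have /choice[s sP] n : exists y : U, forall x, D x -> j x = n -> y = x.
  have [[x Dx jx]|no] := pselect (exists2 x, D x & j x = n).
    by exists x => x' Dx' jx'; apply: j_inj; rewrite ?inE// jx.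
  by exists a => x Dx jx; case: no; exists x.
exists s => x e e0.
have [||y [By Dy]] := D_dense (ball x e)°%classic.
- by exists x; apply: nbhsx_ballx.
- exact: open_interior.
exists (j y); rewrite (sP (j y) y)//.
by have := interior_subset By; rewrite ballEmdist.
Qed.

(** Several isometries are built at once from finite approximations: [P h W] is
the invariant, only the values of [h] on [W] being final.  The sequence [hs] is
part of the conclusion because invariants that mention points outside [W] pass
to the limit by convergence only. *)
Lemma back_and_forth (I : Type) (P : (I -> isom U) -> seq U -> Prop)
    (h0 : I -> isom U) (W0 : seq U) :
  P h0 W0 ->
  (forall (h : I -> isom U) W p, P h W -> exists (h' : I -> isom U) W',
     [/\ P h' W', {subset p :: W <= W'}, forall i, {in W, h' i =1 h i} &
         forall i, exists2 x, x \in W' & h' i x = p]) ->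
  U -> exists (hs : nat -> I -> isom U) (W : nat -> seq U) (h : I -> isom U),
    [/\ forall n, P (hs n) (W n),
        forall m n : nat, (m <= n)%N -> {subset W m <= W n},
        forall x (e : R), 0 < e -> exists n, exists2 w, w \in W n & d x w < e,
        forall i, converges (hs^~ i) (h i) &
        forall n i, {in W n, h i =1 hs n i}].
Proof.
move=> P0 step a; have [s s_dense] := dense_sequence a.
pose S := {hW : (I -> isom U) * seq U | P hW.1 hW.2}.
have /choice[next nextP] (pS : U * S) : exists hW' : S,
    [/\ {subset pS.1 :: (sval pS.2).2 <= (sval hW').2},
        forall i, {in (sval pS.2).2, (sval hW').1 i =1 (sval pS.2).1 i} &
        forall i, exists2 x, x \in (sval hW').2 & (sval hW').1 i x = pS.1].
  case: pS => p [[h W] /= PhW]; have [h' [W' [PhW' ? ? ?]]] := step h W p PhW.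
  by exists (exist _ (h', W') PhW').
pose st := fix st n : S := if n is n'.+1 then next (s n', st n')
                           else exist _ (h0, W0) P0.
pose hs n := (sval (st n)).1; pose W n := (sval (st n)).2.
have Wg n : {subset W n <= W n.+1}.
  have [sub _ _] := nextP (s n, st n).
  by move=> x xW; apply: sub; rewrite inE xW orbT.
have hst i n : {in W n, hs n.+1 i =1 hs n i}.
  by have [_ ag _] := nextP (s n, st n); apply: ag.
have Wd x e : 0 < e -> exists n, exists2 w, w \in W n & d x w < e.
  move=> /(s_dense x)[n xn]; exists n.+1, (s n) => //.
  by have [sub _ _] := nextP (s n, st n); apply/sub/mem_head.
have Wd' i x e : 0 < e -> exists n, exists2 w, w \in W n & d x (hs n i w) < e.
  move=> /(s_dense x)[n xn]; have [_ _ /(_ i)[w wW hw]] := nextP (s n, st n).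
  by exists n.+1, w => //; rewrite [hs _ _ _]hw.
have /choice[h hP] i : exists h, converges (hs^~ i) h /\
    forall n, {in W n, h =1 hs n i}.
  by have [h ? ?] := isometry_limit Wg (hst i) Wd (Wd' i); exists h.
exists hs, W, h; split=> //.
- by move=> n; apply: (svalP (st n)).
- exact: grows_le.
- by move=> i; apply: (hP i).1.
- by move=> n i; apply: (hP i).2.
Qed.

(** * Doubling the displacement *)

(** Invariant: [de <= d t ((g ^ h) s) + d (g t) s] for known points [s] and
[t].  When a point [x] is added, terms in which [x] occurs once reduce to older
ones because the value of [h] at [x] is chosen independent of the images under
[g]; the term in which it occurs twice either reduces in the same way or is at
least [al + be]. *)
Lemma displaces_mulJ (al be de : R) g : displaces al g -> roams be g ->
  de <= 1 -> de <= al + be -> U -> exists h, displaces de (g * g ^ h)%g.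
Proof.
move=> g_al g_be de1 deab a.
pose inv h F := forall s t, s \in F -> t \in F ->
  de <= d (h t) (g (h s)) + d (g t) s.
have dom h F x : inv h F ->
    exists2 h' : isom U, inv h' (x :: F) & {in F, h' =1 h}.
  move=> hF; have [m [mF mg mgV self]] := g_be (map h F) (h x).
  have mh s : s \in F -> m (h s) = h s by move=> sF; rewrite mF ?map_f.
  exists (m * h)%g => [s t|s sF]; last exact: mh.
  rewrite !inE !isomM => /predU1P[->|sF] /predU1P[->|tF].
  - have := g_al x; rewrite sym => gx.
    case: self => [?|[_ [_ [/mapP[u uF ->] /mapP[v vF ->]]]]]; first lra.
    have e w : w \in F -> d (m (h x)) (h w) = d x w.
      by move=> wF; rewrite -(mh w wF) !isom_isometric.
    rewrite (sym (h v)) !e// => le.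
    have := hF v u vF uF; have := tri (g u) (g x) v; have := tri (g x) x v.
    rewrite isom_isometric (sym u x); lra.
  - rewrite mh//; have tx := mdist_ge0 (g t) x.
    case: (mgV (h t) (map_f h tF)) => [|[_ /mapP[u uF ->]]].
      by rewrite isom_distVr sym; lra.
    rewrite -{1}(mh u uF) !isom_isometric !isom_distVr.
    have := hF u t uF tF; have := tri (g t) x u.
    rewrite (sym (g (m _)) (h t)) (sym (g (h u))); lra.
  - rewrite (mh s)//; have := mg (h s) (map_f h sF); have := mdist_ge0 (g x) s.
    move=> ? [?|[_ /mapP[u uF ->]]]; first by lra.
    rewrite -{1}(mh u uF) !isom_isometric.
    have := hF s u sF uF; have := tri (g u) (g x) s.
    by rewrite isom_isometric (sym u x); lra.
  - by rewrite !mh//; apply: hF.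
(* the invariant does not distinguish [h] from its inverse, so extending the
   range is extending the domain for the inverse *)
have invV h F : inv h F -> inv (h^-1)%g (map h F).
  move=> hF _ _ /mapP[s sF ->] /mapP[t tF ->]; rewrite !isomVK.
  by rewrite addrC (sym t) (sym (g (h t))); apply: hF.
pose P (h : unit -> isom U) F := inv (h tt) F.
have [||//|hs [W [h [PW Wm Wd _ hW]]]] :=
  @back_and_forth unit P (fun=> 1%g) [::].
- by [].
- move=> h W p hW.
  have [h1 h1W h1h] := dom (h tt) W p hW.
  have [h2 h2W h2h] := dom (h1^-1)%g (map h1 (p :: W)) p (invV _ _ h1W).
  have {h2W} := invV _ _ h2W; rewrite map_cons => h2W.
  have back x : x \in p :: W -> h2 (h1 x) = x.
    by move=> xW; rewrite h2h ?map_f// isomVK.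
  have h12 x : x \in p :: W -> (h2^-1)%g x = h1 x.
    by move=> /back {1}<-; rewrite isomVK.
  exists (fun=> (h2^-1)%g), (h2 p :: map h2 (map h1 (p :: W))); split.
  + exact: h2W.
  + by move=> x xW; rewrite inE -(back x xW) !map_f ?orbT.
  + by move=> [] x xW; rewrite h12 ?inE ?xW ?orbT// h1h.
  + by move=> []; exists (h2 p); rewrite ?mem_head ?isomVK.
(* the invariant at [s = x] and [t = (g ^ h) x], reached by approximation *)
exists (h tt) => x; apply/ler_addgt0Pr => e e0; rewrite isomM.
set y := (g ^ h tt)%g x.
have [n [s sW xs]] := Wd x (e / 4) ltac:(lra).
have [n' [t tW yt]] := Wd y (e / 4) ltac:(lra).
pose N := maxn n n'.
have sN := Wm _ _ (leq_maxl n n') _ sW; have tN := Wm _ _ (leq_maxr n n') _ tW.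
have := PW N s t sN tN; rewrite -!hW//.
have := tri (h tt t) (h tt y) (g (h tt s)).
have : h tt y = g (h tt x) by rewrite /y isomJ isomKV.
move=> ->; rewrite isom_isometric isom_isometric.
have : d (h tt t) (g (h tt x)) = d t y.
  by rewrite -[in RHS](isom_isometric (h tt)) /y isomJ isomKV.
move=> ->; have := tri (g t) (g y) s; have := tri (g y) x s.
rewrite !isom_isometric (sym t y) (sym (g y) x); lra.
Qed.

(** * Generic conjugates and amalgamation *)

Lemma ind_trans_l B X a c :
  ind B a c -> {in B, forall b, ind X a b} -> ind X a c.
Proof.
move=> /ind_sym Bca XB; apply/ind_sym/(ind_trans Bca) => b bB.
exact/ind_sym/XB.
Qed.

Lemma isomJ_dist k h s t : d t ((k ^ h)%g s) = d (h t) (k (h s)).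
Proof. by rewrite isomJ isom_distVr. Qed.

Lemma isomJ_mulV k h m x : (k ^ (h * m^-1))%g x = m ((k ^ h)%g ((m^-1)%g x)).
Proof. by rewrite conjgM (isomJ (k ^ h)%g) invgK. Qed.

(** A value of a conjugate is determined by the conjugating isometry at the
point and at the value itself, which is why consecutive layers of an orbit are
kept together. *)
Lemma isomJ_agree k h h' x :
  h' x = h x -> h' ((k ^ h)%g x) = h ((k ^ h)%g x) ->
  (k ^ h')%g x = (k ^ h)%g x.
Proof.
rewrite !isomJ => hx hgx; apply: (@isom_inj _ _ h').
by rewrite isomKV hx hgx isomKV.
Qed.

Lemma displacesV al k : displaces al k -> displaces al (k^-1)%g.
Proof. by move=> kal x; rewrite isom_distVr sym. Qed.

(** On [E], distances between points and their images under [g] are as large as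
the values of [g] on [F] permit. *)
Definition free_over g F E := {in E &, forall s t, 1 <= d t (g s) \/
  exists s' t', [/\ s' \in F, t' \in F &
    d t t' + d t' (g s') + d s' s <= d t (g s)]}.

Lemma free_over_ind g F E s t :
  free_over g F E -> s \in E -> t \in E -> ind F (g s) t.
Proof.
move=> fr sE tE; case: (fr s t sE tE) => [?|[s' [t' [s'F t'F le]]]].
  by apply: ind_sym; left.
apply: ind_sym; right; exists t' => //.
by have := tri t' (g s') (g s); rewrite isom_isometric; lra.
Qed.

(** Points of [E] are added one at a time, each sent by [h'] to a position
independent of the images under [k] and [k^-1] of the earlier ones.  The
distance from the new position to its own image cannot be chosen, and this is
where [displaces 1 k] is needed. *)
Lemma generic_conjugate k h F E : displaces 1 k ->
  exists2 h' : isom U, {in F, h' =1 h} & free_over (k ^ h')%g F (E ++ F).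
Proof.
move=> k1; elim: E => [|x E [h1 h1F fr]].
  exists h => // s t sF tF; right; exists s, t.
  by rewrite !mdistxx add0r addr0.
pose G := E ++ F; pose hG := map h1 G.
have [m mG mf] := move_free (h1 x) hG (map k hG ++ map k^-1%g hG).
have mh s : s \in G -> m (h1 s) = h1 s by move=> sG; rewrite mG ?map_f.
exists (m * h1)%g => [s sF|s t].
  by rewrite isomM mh ?h1F// mem_cat sF orbT.
have key u v : u \in G -> v \in G ->
    1 <= d (h1 v) (k (h1 u)) \/ exists s' t', [/\ s' \in F, t' \in F &
    d v t' + d (h1 t') (k (h1 s')) + d s' u <= d (h1 v) (k (h1 u))].
  by move=> uG vG; have := fr u v uG vG; under eq_exists do
    under eq_exists do rewrite !isomJ_dist; rewrite isomJ_dist.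
move=> sG tG; rewrite isomJ_dist !isomM.
have mF s' : s' \in F -> m (h1 s') = h1 s'.
  by move=> s'F; rewrite mh// mem_cat s'F orbT.
suff: 1 <= d (m (h1 t)) (k (m (h1 s))) \/ exists s' t', [/\ s' \in F, t' \in F &
    d t t' + d (h1 t') (k (h1 s')) + d s' s <= d (m (h1 t)) (k (m (h1 s)))].
  case=> [|[s' [t' [s'F t'F le]]]]; first by left.
  right; exists s', t'; split=> //.
  by rewrite isomJ_dist !isomM (mF s')// (mF t').
move: sG tG; rewrite cat_cons !in_cons => /predU1P[->|sG] /predU1P[->|tG].
- by left; apply: k1.
- rewrite (mh t)//.
  have [||[_ /mapP[u uG ->]]] := mf (k^-1%g (h1 t)).
  + by rewrite mem_cat (map_f (k^-1)%g) ?orbT// map_f.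
  + by rewrite isom_distVr sym; left.
  + rewrite -{1}(mh u uG) !isom_isometric !isom_distVr.
    rewrite (sym _ (h1 t)) (sym _ (h1 t)) => le.
    case: (key u t uG tG) => [|[s' [t' [s'F t'F le']]]].
      by have := mdist_ge0 x u; left; lra.
    right; exists s', t'; split=> //.
    have := tri s' u x; rewrite (sym u x); lra.
- rewrite (mh s)//.
  have [||[_ /mapP[u uG ->]]] := mf (k (h1 s)).
  + by rewrite mem_cat map_f// map_f.
  + by left.
  + rewrite -{1}(mh u uG) !isom_isometric => le.
    case: (key s u sG uG) => [|[s' [t' [s'F t'F le']]]].
      by have := mdist_ge0 x u; left; lra.
    right; exists s', t'; split=> //.
    have := tri x u t'; lra.
- by rewrite !mh//; apply: key.
Qed.

(** Since the conjugate is free over [X ++ X1], the images of [E] are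
independent of [E] over [X ++ X1]; they can thus be moved away from [C] while
fixing [E], and [X] itself is independent of [C] over [X1]. *)
Lemma extend_first_step k h X E C (X1 := map (k ^ h)%g X) : displaces 1 k ->
  {in X & C, forall x c, ind X1 x c} ->
  exists2 h' : isom U, {in X ++ X1, h' =1 h} &
    {in E & C, forall e c, ind X1 ((k ^ h')%g e) c}.
Proof.
move=> k1 XC; set F := X ++ X1.
have [h1 h1F fr] := generic_conjugate h F E k1.
have [m mG mC] := move_free_seq (map (k ^ h1)%g E) (E ++ F) C.
have mV x : x \in E ++ F -> (m^-1)%g x = x by move=> /mG/isomV_fix.
exists (h1 * m^-1)%g => [x xF|e c eE cC].
  by rewrite isomM mV ?h1F// mem_cat xF orbT.
rewrite isomJ_mulV mV ?mem_cat ?eE//.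
have iF : ind F (m ((k ^ h1)%g e)) c.
  apply: ind_trans_l (mC _ _ (map_f _ eE) cC) _ => b bG.
  have := free_over_ind (s := e) fr _ bG; rewrite mem_cat eE => /(_ isT).
  move=> /(ind_isom m); rewrite (mG b bG) (_ : map m F = F)//.
  by apply: map_id_in => x xF; rewrite mG// mem_cat xF orbT.
apply: ind_trans iF _ => b; rewrite mem_cat => /orP[bX|bX1]; last exact: ind_l.
exact: XC.
Qed.

(** A shortest path from [b] to the image of [e] uses one known step
[s' -> g s'] of the conjugate.  A step that starts in [X1] is replaced by one
that starts in [X], because [E] is independent of [X1] over [X]; the latter
ends in [X1]. *)
Lemma extend_middle_step k h X E (X1 := map (k ^ h)%g X) : displaces 1 k ->
  {in E & X1, forall e x, ind X e x} ->
  exists2 h' : isom U, {in X ++ X1, h' =1 h} &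
    {in E & X ++ X1 ++ E, forall e b, ind X1 ((k ^ h')%g e) b}.
Proof.
move=> k1 EX; set F := X ++ X1.
have [h1 h1F fr] := generic_conjugate h F E k1.
exists h1 => // e b eE bG.
have gX x : x \in X -> (k ^ h1)%g x \in X1.
  move=> xX; suff -> : (k ^ h1)%g x = (k ^ h)%g x by apply: map_f.
  by apply: isomJ_agree; apply: h1F; rewrite mem_cat ?xX// map_f ?orbT.
have bEF : b \in E ++ F by move: bG; rewrite !mem_cat orbA orbC.
have eEF : e \in E ++ F by rewrite mem_cat eE.
have via s' : s' \in X -> d b ((k ^ h1)%g s') + d s' e <= d b ((k ^ h1)%g e) ->
    ind X1 ((k ^ h1)%g e) b.
  move=> s'X le; apply: ind_sym; right; exists ((k ^ h1)%g s'); rewrite ?gX//.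
  by rewrite isom_isometric.
case: (fr e b eEF bEF) => [?|[s' [t' [s'F t'F le]]]].
  by apply: ind_sym; left.
have bt := tri b t' ((k ^ h1)%g s').
move: s'F; rewrite mem_cat => /orP[s'X|s'X1].
  by apply: (via s') => //; lra.
have := mdist_ge0 b t'; have := mdist_ge0 t' ((k ^ h1)%g s').
case: (EX e s' eE s'X1) => [|[x xX]]; rewrite (sym e s') => es ? ?.
  by apply: ind_sym; left; lra.
apply: (via x) => //.
have := tri b ((k ^ h1)%g s') ((k ^ h1)%g x).
by rewrite isom_isometric (sym s' x) (sym x e); lra.
Qed.

(** The tuples [p E] and [q E] have the same type over [X].  Copy [C] so that
[q E] goes to [p E], and move the copy away from [B] over [X] and [p E]; as
[p E] is independent of [B] over [X], the copy is independent of [B] over [X].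
So is [C], and by stationarity [B] and the copy together are isometric to [B]
and [C]. *)
Lemma amalgamate B C X E (p q : isom U) :
  {subset X <= B} -> {subset X <= C} -> {in B & C, forall b c, ind X b c} ->
  {in E & X, forall e x, d (p e) x = d (q e) x} ->
  {in E & B, forall e b, ind X (p e) b} ->
  exists m n : isom U, [/\ {in B, forall b, m b = b},
    {in C, forall c, n c = c} & {in E, forall e, m (p e) = n (q e)}].
Proof.
move=> XB XC BC pq pB.
have [e1 e1X e1q] : exists2 e1 : isom U,
    {in X, forall x, e1 x = x} & {in E, forall e, e1 (q e) = p e}.
  pose sw y := if y \in X then y else p (q^-1%g y).
  have swq e : e \in E -> sw (q e) = p e.
    rewrite /sw isomVK; case: ifP => // qX eE; apply/esym/mdist_positivity.
    by rewrite pq// mdistxx.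
  have swX x : x \in X -> sw x = x by rewrite /sw => ->.
  have [|e1 e1P] := extend_isometry (L := X ++ map q E) (p := sw).
    move=> y z; rewrite !mem_cat.
    move=> /orP[yX|/mapP[u uE ->]] /orP[zX|/mapP[v vE ->]].
    - by rewrite !swX.
    - by rewrite (swX y)// swq// sym pq// sym.
    - by rewrite (swX z)// swq// pq.
    - by rewrite !swq// !isom_isometric.
  exists e1 => [x xX|e eE]; first by rewrite e1P ?swX// mem_cat xX.
  by rewrite e1P ?swq// mem_cat map_f ?orbT.
have [m mF mC] := move_free_seq (map e1 C) (X ++ map p E) B.
have mX x : x \in X -> m x = x by move=> xX; rewrite mF// mem_cat xX.
have CB c b : c \in C -> b \in B -> ind X (m (e1 c)) b.
  move=> cC bB; apply: ind_trans (mC _ _ (map_f _ cC) bB) _ => y.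
  rewrite mem_cat => /orP[|/mapP[e eE ->]]; first exact: ind_l.
  exact: pB.
have dCB c b : c \in C -> b \in B -> d (m (e1 c)) b = d c b.
  move=> cC bB; apply: (@stationarity X); [|exact: CB|exact/ind_sym/BC].
  by move=> x xX; rewrite -{1}(mX x xX) -{1}(e1X x xX) !isom_isometric.
pose sw y := if y \in B then y else m (e1 y).
have swB b : b \in B -> sw b = b by rewrite /sw => ->.
have swC c : c \in C -> sw c = m (e1 c).
  rewrite /sw; case: ifP => // cB cC; apply/esym/mdist_positivity.
  by rewrite dCB// mdistxx.
have [|n nP] := extend_isometry (L := B ++ C) (p := sw).
  move=> y z; rewrite !mem_cat => /orP[yB|yC] /orP[zB|zC].
  - by rewrite !swB.
  - by rewrite (swB y)// (swC z)// sym dCB// sym.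
  - by rewrite (swB z)// swC// dCB.
  - by rewrite !swC// !isom_isometric.
have nB b : b \in B -> n b = b by move=> bB; rewrite nP ?swB// mem_cat bB.
have nC c : c \in C -> n c = m (e1 c).
  by move=> cC; rewrite nP ?swC// mem_cat cC orbT.
exists (n^-1)%g, (n^-1 * (m * e1))%g; split=> [b /nB/isomV_fix //|c cC|e eE].
- by rewrite !isomM -nC// isomVK.
- by rewrite !isomM e1q// mF// mem_cat map_f ?orbT.
Qed.


(** * Products of four conjugates *)

Definition chain := 'I_4 -> isom U.

Definition chain_of (h0 h1 h2 h3 : isom U) : chain :=
  fun i => nth 1%g [:: h0; h1; h2; h3] i.

Implicit Types u v : chain.

(** The product of the first [n] conjugates of [k]; the factor of index 0 acts
first.  Only [n <= 4] is meaningful, since indices wrap to 0 beyond 3. *)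
Fixpoint walk k u (n : nat) : isom U :=
  if n is n'.+1 then (k ^ u (inord n') * walk k u n')%g else 1%g.

Definition layer k u X n : seq U := map (walk k u n) X.

Lemma layer0 k u X : layer k u X 0 = X.
Proof. exact: map_id. Qed.

Lemma layerS k u X n :
  layer k u X n.+1 = map (k ^ u (inord n))%g (layer k u X n).
Proof. by rewrite /layer -map_comp. Qed.

Lemma walk_agree k u u' X :
  (forall i : 'I_4, {in layer k u X i ++ layer k u X i.+1, u' i =1 u i}) ->
  forall n, (n <= 4)%N -> {in X, walk k u' n =1 walk k u n}.
Proof.
move=> uu'; elim=> [//|n IH] n4 x xX.
have -> : walk k u' n.+1 x = (k ^ u' (inord n))%g (walk k u' n x) by [].
rewrite IH ?(ltnW n4)//.
have i_n : nat_of_ord (@inord 3 n) = n by rewrite inordK.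
by apply: isomJ_agree; apply: uu'; rewrite i_n mem_cat /layer;
  rewrite ?(map_f (walk k u n) xX)// (map_f (walk k u n.+1) xX) orbT.
Qed.

Lemma walk4 k u x : walk k u 4 x =
  (k ^ u (inord 3))%g ((k ^ u (inord 2))%g
    ((k ^ u (inord 1))%g ((k ^ u (inord 0))%g x))).
Proof. by []. Qed.

Lemma chain_ofE h0 h1 h2 h3 (n : nat) : (n < 4)%N ->
  chain_of h0 h1 h2 h3 (inord n) = nth 1%g [:: h0; h1; h2; h3] n.
Proof. by move=> n4; rewrite /chain_of inordK. Qed.

Lemma forall_ord4 (P : 'I_4 -> Prop) :
  (forall i : 'I_4, P i) <->
  [/\ P (inord 0), P (inord 1), P (inord 2) & P (inord 3)].
Proof.
split=> [//|[P0 P1 P2 P3] i]; rewrite -(inord_val i).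
by case: i => -[|[|[|[|]]]].
Qed.

(** Enough independence to keep [X2] between new points that come from the [X0]
side and new points that come from the [X4] side. *)
Definition independent_layers k u X :=
  [/\ {in layer k u X 0 & layer k u X 2 ++ layer k u X 3 ++ layer k u X 4,
        forall x y, ind (layer k u X 1) x y},
      {in layer k u X 1 & layer k u X 3, forall x y, ind (layer k u X 2) x y} &
      {in layer k u X 4 & layer k u X 1 ++ layer k u X 2,
        forall x y, ind (layer k u X 3) x y}].

(** The images [z1] of [E] under the first conjugate are independent of [X2]
over [X1], and the preimages [z3] of [q E] under the last one are independent
of everything on the other side over [X3].  The two middle conjugates then send
[z1] and [z3] to tuples with the same type over [X2], and amalgamation over
[X2] makes these tuples equal. *)
Lemma extend_chain k u X E (q : isom U) :
  displaces 1 k -> independent_layers k u X ->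
  {in X, q =1 walk k u 4} ->
  exists u' : chain,
    (forall i : 'I_4, {in layer k u X i ++ layer k u X i.+1, u' i =1 u i}) /\
    {in E, walk k u' 4 =1 q}.
Proof.
move=> k1 [G1 G2 G3] qX.
set X0 := layer k u X 0 in G1; set X1 := layer k u X 1 in G1 G2 G3.
set X2 := layer k u X 2 in G1 G2 G3; set X3 := layer k u X 3 in G1 G2 G3.
set X4 := layer k u X 4 in G1 G3.
pose g i := (k ^ u (inord i))%g.
have E1 : X1 = map (g 0%N) X0 by apply: layerS.
have E2 : X2 = map (g 1%N) X1 by apply: layerS.
have E3 : X3 = map (g 2%N) X2 by apply: layerS.
have E4 : X4 = map (g 3%N) X3 by apply: layerS.
have E3' : X3 = map ((k^-1) ^ u (inord 3))%g X4.
  rewrite E4 -map_comp -[LHS]map_id; apply: eq_map => x.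
  by rewrite /comp conjVg isomVK.
have [h0 h0a z1f] : exists2 h0 : isom U, {in X0 ++ X1, h0 =1 u (inord 0)} &
    {in E & X2 ++ X3 ++ X4, forall e c, ind X1 ((k ^ h0)%g e) c}.
  by rewrite E1; apply: extend_first_step => //; rewrite -E1.
set z1 := map (k ^ h0)%g E.
have z1_2 e c : e \in z1 -> c \in X2 -> ind X1 e c.
  by move=> /mapP[e' e'E ->] cX; apply: z1f; rewrite ?mem_cat ?cX.
have z1_3 e c : e \in z1 -> c \in X3 -> ind X2 e c.
  move=> /mapP[e' e'E ->] cX; apply: ind_trans (_ : ind X1 _ c) _.
    by apply: z1f; rewrite ?mem_cat ?cX ?orbT.
  by move=> b bX; apply: G2.
have z1_4 e c : e \in z1 -> c \in X4 -> ind X3 c e.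
  move=> /mapP[e' e'E ->] cX; apply: ind_sym.
  apply: ind_trans (_ : ind X1 _ c) _.
    by apply: z1f; rewrite ?mem_cat ?cX ?orbT.
  by move=> b bX; apply/ind_sym/G3; rewrite ?mem_cat ?bX.
have [h3 h3a z3f] : exists2 h3 : isom U, {in X4 ++ X3, h3 =1 u (inord 3)} &
    {in map q E & X1 ++ X2 ++ z1, forall e c,
      ind X3 (((k^-1) ^ h3)%g e) c}.
  rewrite E3'; apply: extend_first_step; first exact: displacesV.
  rewrite -E3' => x c xX; rewrite catA mem_cat => /orP[cX|cz]; first exact: G3.
  exact: z1_4.
set z3 := map ((k^-1) ^ h3)%g (map q E).
have z3_1 e c : e \in z3 -> c \in X1 -> ind X2 e c.
  move=> /mapP[e' e'E ->] cX; apply: ind_trans (_ : ind X3 _ c) _.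
    by apply: z3f; rewrite ?mem_cat ?cX ?orbT.
  by move=> b bX; apply/ind_sym/G2.
have z3_z1 e c : e \in z3 -> c \in z1 -> ind X2 e c.
  move=> /mapP[e' e'E ->] cX; apply: ind_trans (_ : ind X3 _ c) _.
    by apply: z3f; rewrite ?mem_cat ?cX ?orbT.
  by move=> b bX; apply/ind_sym/z1_3.
have [h1 h1a z2f] : exists2 h1 : isom U, {in X1 ++ X2, h1 =1 u (inord 1)} &
    {in z1 & X1 ++ X2 ++ z1, forall e b, ind X2 ((k ^ h1)%g e) b}.
  by rewrite E2; apply: extend_middle_step => //; rewrite -E2.
pose p := ((k ^ h1) * (k ^ h0))%g.
pose p' := ((g 2%N)^-1 * (((k^-1) ^ h3) * q))%g.
have [|||||c [c' [cB cC cc']]] :=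
  @amalgamate (X1 ++ X2 ++ z1) (X2 ++ X3 ++ z3) X2 E p p'.
- by move=> x xX; rewrite !mem_cat xX orbT.
- by move=> x xX; rewrite !mem_cat xX.
- move=> x y; rewrite !mem_cat => /or3P[xX|xX|xX].
  + case/or3P=> [yX|yX|yX]; [exact: ind_r|exact: G2|exact/ind_sym/z3_1].
  + by move=> _; apply: ind_l.
  + case/or3P=> [yX|yX|yX]; [exact: ind_r|exact: z1_3|exact/ind_sym/z3_z1].
- move=> e _ eE /mapP[y yX ->].
  have in_layer n : walk k u n y \in layer k u X n by apply: map_f.
  have y0 : (k ^ h0)%g y = g 0%N y.
    apply: isomJ_agree; apply: h0a; rewrite mem_cat.
      by rewrite (in_layer 0%N).
    by rewrite (in_layer 1%N) orbT.
  have y1 : (k ^ h1)%g (g 0%N y) = g 1%N (g 0%N y).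
    apply: isomJ_agree; apply: h1a; rewrite mem_cat.
      by rewrite (in_layer 1%N).
    by rewrite (in_layer 2%N) orbT.
  have y3 : (k ^ h3)%g (walk k u 3 y) = walk k u 4 y.
    apply: isomJ_agree; apply: h3a; rewrite mem_cat.
      by rewrite (in_layer 3%N) orbT.
    by rewrite (in_layer 4%N).
  have py : p y = walk k u 2 y by rewrite /p isomM y0 y1.
  have p'y : p' y = walk k u 2 y.
    by rewrite /p' 2!isomM qX// -y3 conjVg isomVK isomVK.
  by rewrite -{1}py -p'y !isom_isometric.
- by move=> e b eE bB; apply: z2f; rewrite ?map_f.
have cV b : b \in X1 ++ X2 ++ z1 -> (c^-1)%g b = b by move=> /cB/isomV_fix.
have c'V b : b \in X2 ++ X3 ++ z3 -> (c'^-1)%g b = b by move=> /cC/isomV_fix.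
exists (chain_of h0 (h1 * c^-1)%g (u (inord 2) * c'^-1)%g h3); split.
  apply/forall_ord4; rewrite !chain_ofE// !inordK//; cbn [nth]; split.
  - exact: h0a.
  - move=> x xX; rewrite isomM cV ?h1a//.
    by move: xX; rewrite !mem_cat => /orP[]->; rewrite ?orbT.
  - move=> x xX; rewrite isomM c'V//.
    by move: xX; rewrite !mem_cat => /orP[]->; rewrite ?orbT.
  - by move=> x xX; apply: h3a; move: xX; rewrite !mem_cat orbC.
move=> e eE; rewrite walk4 !chain_ofE//; cbn [nth].
have eX1 : (k ^ h0)%g e \in X1 ++ X2 ++ z1.
  by rewrite !mem_cat (map_f (k ^ h0)%g eE) !orbT.
have eX3 : ((k^-1) ^ h3)%g (q e) \in X2 ++ X3 ++ z3.
  by rewrite !mem_cat (map_f ((k^-1) ^ h3)%g (map_f q eE)) !orbT.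
rewrite (isomJ_mulV k h1) cV// -[(k ^ h1)%g _]/(p e) cc'// isomJ_mulV isomVK.
rewrite -[p' e]/((g 2%N)^-1%g (((k^-1) ^ h3)%g (q e))) (isomKV (g 2%N)) cC//.
by rewrite conjVg (isomKV (k ^ h3)%g).
Qed.

(** The layers are made outwards from the middle one: each conjugating isometry
is multiplied by one that fixes a layer pointwise and moves the next layer away
from those already made.  Enough images and preimages of [A] are put into the
middle layer for [A] to lie in every layer, hence to be fixed by these changes. *)
Lemma make_layers_independent k u A : exists u' X,
  [/\ forall i, {in A, u' i =1 u i}, independent_layers k u' X &
      forall n, (n <= 4)%N -> {subset A <= layer k u' X n}].
Proof.
pose g i := (k ^ u (inord i))%g.
pose X2 := A ++ map (g 0%N) A ++ map (g 1%N) A ++ map (g 1%N * g 0%N)%g A ++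
  map (g 2%N)^-1%g A ++ map ((g 2%N)^-1 * (g 3%N)^-1)%g A.
have A2 (f : isom U) : f \in [:: 1; g 0%N; g 1%N; g 1%N * g 0%N; (g 2%N)^-1;
    (g 2%N)^-1 * (g 3%N)^-1]%g -> {in A, forall a, f a \in X2}.
  move=> + a aA; rewrite !inE /X2 !mem_cat.
  by case/or4P => [||| /or3P[]] /eqP->; rewrite ?isom1 ?aA ?(map_f _ aA) ?orbT.
pose X3 := map (g 2%N) X2.
have [m1 m1F m1C] := move_free_seq (map (g 1%N)^-1%g X2) X2 X3.
pose X1 := map m1 (map (g 1%N)^-1%g X2).
have [m3 m3F m3C] := move_free_seq (map (g 3%N) X3) X3 (X1 ++ X2).
pose X4 := map m3 (map (g 3%N) X3).
have [m0 m0F m0C] := move_free_seq (map (g 0%N)^-1%g X1) X1 (X2 ++ X3 ++ X4).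
pose X0 := map m0 (map (g 0%N)^-1%g X1).
pose u' := chain_of (u (inord 0) * m0^-1)%g (u (inord 1) * m1^-1)%g
  (u (inord 2)) (u (inord 3) * m3^-1)%g.
have AX2 : {subset A <= X2} by move=> a aA; rewrite mem_cat aA.
have AX1 : {subset A <= X1}.
  move=> a aA; rewrite -(m1F a (AX2 _ aA)) -{1}(isomVK (g 1%N) a).
  by do 2!apply: map_f; apply: A2; rewrite // !inE eqxx ?orbT.
have AX0 : {subset A <= X0}.
  move=> a aA; rewrite -(m0F a (AX1 _ aA)) -{1}(isomVK (g 0%N) a).
  have g0a : g 0%N a \in X2 by apply: A2; rewrite // !inE eqxx ?orbT.
  do 2!apply: map_f; rewrite -(m1F _ g0a) -{1}(isomVK (g 1%N) (g 0%N a)).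
  do 2!apply: map_f; apply: (A2 (g 1%N * g 0%N)%g) => //.
  by rewrite !inE eqxx ?orbT.
have AX3 : {subset A <= X3}.
  move=> a aA; rewrite -(isomKV (g 2%N) a).
  by apply: map_f; apply: A2; rewrite // !inE eqxx ?orbT.
have AX4 : {subset A <= X4}.
  move=> a aA; rewrite -(m3F a (AX3 _ aA)) -{1}(isomKV (g 3%N) a).
  do 2!apply: map_f; rewrite -(isomKV (g 2%N) (_ a)).
  apply: map_f; apply: (A2 ((g 2%N)^-1 * (g 3%N)^-1)%g) => //.
  by rewrite !inE eqxx ?orbT.
have fixV (m : isom U) F : {in F, forall x, m x = x} ->
    {in F, forall x, (m^-1)%g x = x}.
  by move=> mF x /mF/isomV_fix.
have L0 : layer k u' X0 0 = X0 by apply: layer0.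
have L1 : layer k u' X0 1 = X1.
  rewrite layerS L0 /X0 -2!map_comp /u' chain_ofE// [nth _ _ _]/=.
  apply: map_id_in => x xX.
  by rewrite /comp isomJ_mulV isomVK isomKV m0F.
have L2 : layer k u' X0 2 = X2.
  rewrite layerS L1 /X1 -2!map_comp /u' chain_ofE// [nth _ _ _]/=.
  apply: map_id_in => x xX.
  by rewrite /comp isomJ_mulV isomVK isomKV m1F.
have L3 : layer k u' X0 3 = X3 by rewrite layerS L2 /u' chain_ofE.
have L4 : layer k u' X0 4 = X4.
  rewrite layerS L3 /X4 -map_comp /u' chain_ofE// [nth _ _ _]/=.
  apply/eq_in_map => x xX.
  by rewrite /comp isomJ_mulV (fixV _ _ m3F).
exists u', X0; split.
- apply/forall_ord4; rewrite /u' !chain_ofE//; cbn [nth].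
  split=> // a aA; rewrite isomM.
  + by rewrite (fixV _ _ m0F)//; apply: AX1.
  + by rewrite (fixV _ _ m1F)//; apply: AX2.
  + by rewrite (fixV _ _ m3F)//; apply: AX3.
- rewrite /independent_layers L0 L1 L2 L3 L4; split.
  + by move=> _ y /mapP[x xX ->] yX; apply: m0C.
  + by move=> _ y /mapP[x xX ->] yX; apply: m1C.
  + by move=> _ y /mapP[x xX ->] yX; apply: m3C.
- by move=> [|[|[|[|[|]]]]]//= _; rewrite ?L0 ?L1 ?L2 ?L3 ?L4.
Qed.

(** The equation [V * f = U] holds on the first layer of [U], where [U] is
ready to be extended. *)
Definition solved_on k u v (f : isom U) X :=
  independent_layers k u X /\ {in X, forall x, walk k v 4 (f x) = walk k u 4 x}.

(** Making the layers of [V] independent changes no value of [V] on [f X], so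
the equation persists on [X].  Then [U] can be extended to solve it on the
preimage under [f] of the first layer of [V], which is the situation for [f^-1]
with the two sides exchanged. *)
Lemma solve_other_side k u v (f : isom U) X A :
  displaces 1 k -> solved_on k u v f X ->
  exists u' v' Y, [/\ solved_on k v' u' f^-1%g Y,
    forall i, {in A, v' i =1 v i},
    forall i : 'I_4, {in layer k u X i ++ layer k u X i.+1, u' i =1 u i} &
    forall n, (n <= 4)%N -> {subset A <= layer k v' Y n}].
Proof.
move=> k1 [indX vfu].
pose path n := layer k v (map f X) n.
pose A' := A ++ path 0%N ++ path 1%N ++ path 2%N ++ path 3%N ++ path 4%N.
have [v' [Y [v'A indY AY]]] := make_layers_independent k v A'.
have v'v : {in X, forall x, walk k v' 4 (f x) = walk k v 4 (f x)}.
  move=> x xX; apply: (@walk_agree k v v' (map f X)); rewrite ?map_f//.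
  apply/forall_ord4; rewrite !inordK//; split=> y yp; apply: v'A; move: yp;
  by rewrite !mem_cat => /orP[]->; rewrite ?orbT.
have [|u' [u'u u'f]] :=
  @extend_chain k u X (map f^-1%g Y) (walk k v' 4 * f)%g k1 indX.
  by move=> x xX; rewrite isomM v'v// vfu.
exists u', v', Y; split=> //.
- split=> // y yY; rewrite u'f ?map_f// isomM isomKV//.
- by move=> i a aA; apply: v'A; rewrite mem_cat aA.
- by move=> n n4 a aA; apply: AY; rewrite // mem_cat aA.
Qed.

Lemma converges_walk k (us : nat -> chain) (u : chain) :
  (forall i, converges (us^~ i) (u i)) ->
  forall n, converges (fun j => walk k (us j) n) (walk k u n).
Proof.
move=> cu; elim=> [|n IH]; first exact: converges_const.
apply: converges_mul IH; apply: converges_mul; first exact/converges_inv/cu.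
by apply: converges_mul; [exact: converges_const|exact: cu].
Qed.

(** One back-and-forth step is two moves of [solve_other_side], one for each
side.  The preimages of the prescribed point are put among the points to be
kept just before the layers of the corresponding side are made independent. *)
Lemma factorisation k f : displaces 1 k -> U ->
  exists u v : chain, f = ((walk k v 4)^-1 * walk k u 4)%g.
Proof.
move=> k1 a.
pose fst_chain (h : bool * 'I_4 -> isom U) : chain := fun i => h (true, i).
pose snd_chain (h : bool * 'I_4 -> isom U) : chain := fun i => h (false, i).
pose P (h : bool * 'I_4 -> isom U) (W : seq U) := exists X,
  solved_on k (fst_chain h) (snd_chain h) f X /\
  forall n, (n <= 4)%N -> {subset W <= layer k (fst_chain h) X n}.
have [||//|hs [W [h [PW Wm Wd ch _]]]] :=
    back_and_forth (P := P) (h0 := fun=> 1%g) (W0 := [::]).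
- by exists [::]; split=> [|n _ x //]; split=> [|x //]; split=> x y //=.
- move=> h W p [X [rX WX]].
  set u := fst_chain h in rX WX; set v := snd_chain h in rX.
  pose A1 := (p :: W) ++ [seq (v i)^-1%g p | i <- enum 'I_4].
  have [u1 [v1 [Y [rY v1v u1u A1Y]]]] := solve_other_side A1 k1 rX.
  pose A2 := A1 ++ [seq (u1 i)^-1%g p | i <- enum 'I_4].
  have [v2 [u2 [Z [rZ u2u1 v2v1 A2Z]]]] := solve_other_side A2 k1 rY.
  rewrite invgK in rZ.
  have A12 : {subset A1 <= A2} by move=> x xA; rewrite mem_cat xA.
  have WA1 : {subset p :: W <= A1} by move=> x xA; rewrite mem_cat xA.
  have v2v (i : 'I_4) : {in A1, v2 i =1 v i}.
    move=> x xA; rewrite v2v1 ?v1v// mem_cat A1Y//; apply/ltnW/ltn_ord.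
  exists (fun bi => if bi.1 then u2 bi.2 else v2 bi.2), A2; split.
  + by exists Z; split.
  + by move=> x xW; apply/A12/WA1.
  + move=> [[] i] x xW /=; last by rewrite v2v ?WA1// inE xW orbT.
    rewrite u2u1 ?u1u//; last by apply/A12/WA1; rewrite inE xW orbT.
    by rewrite mem_cat WX//; apply/ltnW/ltn_ord.
  + move=> [[] i] /=.
    * exists ((u1 i)^-1%g p).
        by rewrite mem_cat (map_f (fun j => (u1 j)^-1%g p)) ?mem_enum ?orbT.
      rewrite u2u1 ?isomKV//.
      by rewrite mem_cat (map_f (fun j => (u1 j)^-1%g p)) ?mem_enum ?orbT.
    * have vA1 : (v i)^-1%g p \in A1.
        by rewrite mem_cat (map_f (fun j => (v j)^-1%g p)) ?mem_enum ?orbT.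
      by exists ((v i)^-1%g p); [exact: A12|rewrite v2v// isomKV].
pose u := fst_chain h; pose v := snd_chain h.
have cu : converges (fun n => walk k (fst_chain (hs n)) 4) (walk k u 4).
  by apply: converges_walk => i; apply: ch.
have cv : converges (fun n => walk k (snd_chain (hs n)) 4 * f)%g
    (walk k v 4 * f)%g.
  apply: converges_mul (converges_const f).
  by apply: converges_walk => i; apply: ch.
have vfuW n w : w \in W n -> walk k v 4 (f w) = walk k u 4 w.
  move=> wW; apply: small_eq => e e0.
  have [N1 N1P] := cu w (e / 2) ltac:(lra).
  have [N2 N2P] := cv w (e / 2) ltac:(lra).
  pose N := maxn n (maxn N1 N2).
  have nN : (n <= N)%N by apply: leq_maxl.
  have N1N : (N1 <= N)%N by rewrite !leq_max leqnn orbT.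
  have N2N : (N2 <= N)%N by rewrite !leq_max leqnn !orbT.
  have [X [[_ vfuX] WX]] := PW N.
  have wX : w \in X.
    by rewrite -(layer0 k (fst_chain (hs N)) X) WX//; apply: Wm wW.
  have y1 := N1P _ N1N.
  have y2 : d (walk k (snd_chain (hs N)) 4 (f w)) (walk k v 4 (f w)) < e / 2.
    exact: N2P.
  move: y1 y2; rewrite (vfuX _ wX); set y := walk k _ 4 w => y1 y2.
  have := tri (walk k v 4 (f w)) y (walk k u 4 w).
  by rewrite (sym (walk k v 4 _) y); lra.
have vfu x : walk k v 4 (f x) = walk k u 4 x.
  apply: small_eq => e e0; have [n [w wW xw]] := Wd x (e / 2) ltac:(lra).
  have := tri (walk k v 4 (f x)) (walk k v 4 (f w)) (walk k u 4 x).
  by rewrite {2}(vfuW _ _ wW) !isom_isometric (sym w x); lra.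
exists u, v; apply: isom_ext => x.
have -> : ((walk k v 4)^-1 * walk k u 4)%g x =
    ((walk k v 4)^-1)%g (walk k u 4 x) by [].
by rewrite -vfu isomVK.
Qed.

(** * Counting conjugates *)

Definition conj_product g n f :=
  exists2 l : seq (isom U), size l = n & f = (\prod_(h <- l) g ^ h)%g.

Lemma conj_product1 g : conj_product g 1 g.
Proof. by exists [:: 1%g]; rewrite // big_seq1 conjg1. Qed.

Lemma conj_productM g (n m : nat) (f f' : isom U) :
  conj_product g n f -> conj_product g m f' ->
  conj_product g (n + m) (f * f')%g.
Proof.
move=> [l <- ->] [l' <- ->]; exists (l ++ l'); first by rewrite size_cat.
by rewrite big_cat.
Qed.

Lemma conj_productJ g n f h : conj_product g n f -> conj_product g n (f ^ h)%g.
Proof.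
move=> [l <- ->]; exists (map (fun h' => (h' * h)%g) l).
  by rewrite size_map.
by rewrite conjg_prod big_map; apply: eq_bigr => h' _; rewrite conjgM.
Qed.

Lemma conj_productV g n f : conj_product g n f -> conj_product g^-1%g n f^-1%g.
Proof.
move=> [l <- ->]; exists (rev l); first by rewrite size_rev.
rewrite -[in LHS](revK l) -prodgV; apply: eq_bigr => h' _.
by rewrite conjVg.
Qed.

Lemma conj_product_walk g n k (u : chain) :
  conj_product g n k -> conj_product g (n + (n + (n + n))) (walk k u 4).
Proof.
move=> gk; have gJ i := conj_productJ (u (inord i)) gk.
rewrite /walk mulg1.
exact: (conj_productM (gJ 3%N) (conj_productM (gJ 2%N)
  (conj_productM (gJ 1%N) (gJ 0%N)))).
Qed.

Lemma conj_product_ord g n f : conj_product g n f ->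
  exists h : 'I_n -> isom U, f = (\prod_(i < n) g ^ h i)%g.
Proof.
move=> [l <- ->]; exists (fun i => nth 1%g l i).
by rewrite (big_nth 1%g) big_mkord.
Qed.

Lemma signed_conj_product g n1 n2 (N : nat) (f1 f2 : isom U) :
  N = (n1 + n2)%N ->
  conj_product g^-1%g n1 f1 -> conj_product g n2 f2 ->
  exists (h : 'I_N -> isom U) (s : 'I_N -> bool),
    (f1 * f2 = \prod_(i < N) ((if s i then g else g^-1) ^ h i))%g.
Proof.
move=> -> /conj_product_ord[h1 ->] /conj_product_ord[h2 ->].
exists (fun i : 'I_(n1 + n2) =>
  match fintype.split i with inl j => h1 j | inr j => h2 j end).
exists (fun i : 'I_(n1 + n2) =>
  match fintype.split i with inl _ => false | inr _ => true end).
rewrite big_split_ord; congr (_ * _)%g; apply: eq_bigr => j _.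
- by rewrite -[lshift n2 j]/(unsplit (inl j)) unsplitK.
- by rewrite -[rshift n1 j]/(unsplit (inr j)) unsplitK.
Qed.

(** The first doubling starts from displacement 0 and roaming 1/2, the second
one from 1/2 and 1/2; from then on 0 is used as the lower bound for the
displacement already present, so that the sum stays 1. *)
Lemma displacing_product g a n : d a (g a) = 1 ->
  exists2 f : isom U, conj_product g (2 ^ n.+2) f & displaces 1 f.
Proof.
move=> ga; have double (al be : R) (m : nat) f : conj_product g m f ->
    displaces al f -> roams be f -> al + be <= 1 ->
    exists2 f' : isom U, conj_product g (m + m) f' & displaces (al + be) f'.
  move=> gf f_al f_be ab1.
  have [h hP] := displaces_mulJ f_al f_be ab1 (lexx _) a.
  by exists (f * f ^ h)%g => //; apply/conj_productM/conj_productJ.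
elim: n => [|n [f gf f1]]; last first.
  have f0 : displaces 0 f by move=> x; exact: mdist_ge0.
  rewrite expnS mul2n -addnn.
  have [|f' gf' f'1] := double 0 1 _ f gf f0 (displaces_roams f1).
    by rewrite add0r.
  by exists f' => //; rewrite -[1]add0r.
have g0 : displaces 0 g by move=> x; exact: mdist_ge0.
have [|f gf fh] := double 0 2^-1 _ g (conj_product1 g) g0 (moved_roams ga).
  by lra.
rewrite add0r in fh.
have [|f' gf' f'1] := double _ _ _ f gf fh (displaces_roams fh); first lra.
exists f' => // x; have := f'1 x; lra.
Qed.

(** Any realisation will do, for instance [a] itself. *)
Lemma displaces_almost_maximally f :
  displaces 1 f -> moves_almost_maximally f.
Proof.
move=> f1 X a _; exists a => // x y /= -> ->.
by rewrite ltNge f1.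
Qed.

End Urysohn.

Theorem proposition1p3 (R : realType) (U : metricType R)
    (hU : bounded_urysohn U) (g : isom U)
    (hg : exists a : U, mdist a (g a) = 1) :
  (exists h : 'I_(2 ^ 5) -> isom U,
     moves_almost_maximally (\prod_(i < 2 ^ 5) (g ^ h i))%g) /\
  (forall f : isom U,
     exists (h : 'I_(2 ^ 9) -> isom U) (s : 'I_(2 ^ 9) -> bool),
       f = (\prod_(i < 2 ^ 9) ((if s i then g else g^-1) ^ h i))%g).
Proof.
have [a ga] := hg; split=> [|f].
  have [f gf f1] := displacing_product hU 3 ga.
  have [h fh] := conj_product_ord gf.
  by exists h; rewrite -fh; apply: displaces_almost_maximally.
have [k gk k1] := displacing_product hU 4 ga.
have [u [v ->]] := factorisation hU f k1 a.
have gv := conj_productV (conj_product_walk v gk).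
exact: signed_conj_product gv (conj_product_walk u gk).
Qed.
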